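(* Let $n>1$, $p>1$ and $m\ge 1$ be integers. Then $\theta(mH_{n,p})=0$ if $n$ is even or $mnp$ is odd, and $\theta(mH_{n,p})=1$ otherwise.
   Context: $H_{n,p}$ denotes the complete multipartite graph with $p$ parts each having exactly $n$ vertices, and $mH_{n,p}$ denotes the disjoint union of $m$ copies of $H_{n,p}$. For a finite set $S$ of positive integers with $|S|=|V(G)|$, a graph $G$ is $S$-magic if there is a bijection $f:V(G)\to S$ and a constant $c$ with $\sum_{v\in N(u)} f(v)=c$ for every vertex $u$, where $N(u)$ is the set of neighbours of $u$. Let $\alpha(S)=\max S$ and $i(G)=\min \alpha(S)$ over all $S$ for which $G$ is $S$-magic; the distance magic index is $\theta(G)=i(G)-|V(G)|$ (and $\theta(G)=\infty$ if no such $S$ exists). *)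

(* Defs.v *)
From HB Require Import structures.
From mathcomp Require Import all_boot all_order all_algebra.
From mathcomp Require Import finmap boolp.

Set Implicit Arguments.
Unset Strict Implicit.
Unset Printing Implicit Defensive.

Record sgraph := SGraph {
  svertex :> finType;
  sedge : rel svertex;
  sedge_sym : symmetric sedge;
  sedge_irr : irreflexive sedge
}.

Definition nbrs (G : sgraph) (u : G) : {set G} := [set v | sedge u v].

Section CompleteMultipartite.
Variables n p : nat.

(* The vertex (a, b) is the b-th vertex of the a-th part. *)
Definition cmp_edge : rel ('I_p * 'I_n)%type := fun u v => u.1 != v.1.

Fact cmp_edge_sym : symmetric cmp_edge.
Proof. by move=> u v; rewrite /cmp_edge eq_sym. Qed.

Fact cmp_edge_irr : irreflexive cmp_edge.
Proof. by move=> u; rewrite /cmp_edge eqxx. Qed.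

Definition complete_multipartite : sgraph :=
  SGraph cmp_edge_sym cmp_edge_irr.

End CompleteMultipartite.

Section Copies.
Variables (m : nat) (G : sgraph).

Definition copies_edge : rel ('I_m * G)%type :=
  fun u v => (u.1 == v.1) && sedge u.2 v.2.

Fact copies_edge_sym : symmetric copies_edge.
Proof. by move=> u v; rewrite /copies_edge eq_sym sedge_sym. Qed.

Fact copies_edge_irr : irreflexive copies_edge.
Proof. by move=> u; rewrite /copies_edge sedge_irr andbF. Qed.

Definition copies : sgraph := SGraph copies_edge_sym copies_edge_irr.

End Copies.

Definition S_magic (G : sgraph) (S : {fset nat}) : Prop :=
  [/\ (forall x, x \in S -> 0 < x),
      #|` S| = #|G| &
      exists f : G -> S, bijective f /\
        exists c : nat, forall u : G, \sum_(v in nbrs u) fsval (f v) = c].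

Definition alpha (S : {fset nat}) : nat := \max_(x <- S) x.

Definition magic_alphas (G : sgraph) : pred nat :=
  fun k => `[< exists S : {fset nat}, S_magic G S /\ alpha S = k >].

(* None stands for infinity. *)
Definition i_index (G : sgraph) : option nat :=
  match pselect (exists k, magic_alphas G k) with
  | left ex_k => Some (ex_minn ex_k)
  | right _ => None
  end.

Definition theta (G : sgraph) : option int :=
  omap (fun k : nat => (k%:Z - #|G|%:Z)%R) (i_index G).

(* Main.v *)
Require Import Defs.
From HB Require Import structures.
From mathcomp Require Import all_boot all_order all_algebra.
From mathcomp Require Import finmap boolp.
From mathcomp Require Import zify.

Set Implicit Arguments.
Unset Strict Implicit.
Unset Printing Implicit Defensive.

(** A labelling of [m H_{n,p}] is magic exactly when all [k = m p] parts have the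
    same label sum, so the question is to split a set of [k n] positive integers
    into [k] blocks of size [n] with equal sums.  Two consecutive runs of [k]
    integers, one increasing and one decreasing, add the same amount to every
    block; this settles even [n] and reduces odd [n] to [n = 3].  For [n = 3],
    add to [i] a permutation [pi i] of [0 .. k-1] for which the sums [i + pi i]
    are distinct and fill an interval, up to its midpoint when [k] is even; the
    third run compensates these sums, and for even [k] it leaves one integer out.
    When [n] is odd and [k] even, the set [{1, .., k n}] itself is impossible
    because twice the block sum would be the odd number [n (k n + 1)]. *)

(** * Arrays with equal row sums *)

Definition balanced_array (k n N : nat) (g : nat -> nat -> nat) : Prop :=
  [/\ forall i j i' j', i < k -> j < n -> i' < k -> j' < n ->
        g i j = g i' j' -> i = i' /\ j = j',
      forall i j, i < k -> j < n -> g i j < N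
    & forall i i', i < k -> i' < k -> \sum_(j < n) g i j = \sum_(j < n) g i' j].

Definition zigzag (k i j : nat) : nat := j * k + (if odd j then k.-1 - i else i).

Lemma digits_inj (k j r j' r' : nat) :
  r < k -> r' < k -> j * k + r = j' * k + r' -> j = j' /\ r = r'.
Proof.
move=> hr hr' E.
have k0 : 0 < k by lia.
have : (j * k + r) %/ k = (j' * k + r') %/ k by rewrite E.
rewrite !divnMDl // !divn_small // !addn0 => ejj; subst j'.
by split=> //; lia.
Qed.

Lemma zigzag_inj (k i j i' j' : nat) :
  i < k -> i' < k -> zigzag k i j = zigzag k i' j' -> i = i' /\ j = j'.
Proof.
move=> hi hi' /digits_inj [||<-]; by case: ifP; lia.
Qed.

Lemma zigzag_lt (k n i j : nat) : i < k -> j < n -> zigzag k i j < n * k.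
Proof.
move=> hi hj; rewrite /zigzag.
have : j.+1 * k <= n * k by rewrite leq_mul2r hj orbT.
by case: ifP; lia.
Qed.

(** Columns [2q] and [2q+1] contribute [i] and [k-1-i], so [i] cancels in each pair. The offset [b]
    lets the zigzag start after the first three columns of [odd_array]. *)
Lemma sum_zigzag (k b q i i' : nat) : i < k -> i' < k ->
  \sum_(j < q.*2) (b + zigzag k i j) = \sum_(j < q.*2) (b + zigzag k i' j).
Proof.
move=> hi hi'; elim: q => [|q IH]; first by rewrite !big_ord0.
rewrite doubleS !big_ord_recr /= IH /zigzag /= odd_double /=.
lia.
Qed.

Lemma balanced_array_even (k n : nat) :
  ~~ odd n -> balanced_array k n (k * n) (zigzag k).
Proof.
move=> en; split.
- by move=> i j i' j' hi hj hi' hj'; apply: zigzag_inj.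
- by move=> i j hi hj; rewrite mulnC; apply: zigzag_lt.
move=> i i' hi hi'; rewrite -(even_halfK en).
exact: (@sum_zigzag k 0).
Qed.

(** Indices [2t] descend from the middle, indices [2t+1] from [k-1]. The sums [i + mid_perm k i] are
    then [k.-1./2 + t] and [k + t]: no gap for odd [k], and only [k-1] skipped for even [k]. *)
Definition mid_perm (k i : nat) : nat :=
  (if odd i then k.-1 else k.-1./2) - i./2.

(** For [i < k] the largest value of [i + mid_perm k i] is [k.-1 + k./2], so the truncated
    subtraction is exact and each row adds up to [3k + k.-1 + k./2]. *)
Definition triple (k i j : nat) : nat :=
  match j with
  | 0 => i
  | 1 => k + mid_perm k i
  | _ => k.*2 + (k.-1 + k./2 - (i + mid_perm k i))
  end.

Definition odd_array (k i j : nat) : nat :=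
  if j < 3 then triple k i j else 3 * k + ~~ odd k + zigzag k i (j - 3).

Lemma mid_perm_lt (k i : nat) : i < k -> mid_perm k i < k.
Proof. rewrite /mid_perm; case: ifP; lia. Qed.

Lemma mid_perm_inj (k i i' : nat) :
  i < k -> i' < k -> mid_perm k i = mid_perm k i' -> i = i'.
Proof. rewrite /mid_perm; case: ifP; case: ifP; lia. Qed.

Lemma add_mid_perm_le (k i : nat) : i < k -> i + mid_perm k i <= k.-1 + k./2.
Proof. rewrite /mid_perm; case: ifP; lia. Qed.

Lemma add_mid_perm_ge (k i : nat) : i < k -> k.-1./2 <= i + mid_perm k i.
Proof. rewrite /mid_perm; case: ifP; lia. Qed.

Lemma add_mid_perm_inj (k i i' : nat) :
  i < k -> i' < k -> i + mid_perm k i = i' + mid_perm k i' -> i = i'.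
Proof. rewrite /mid_perm; case: ifP; case: ifP; lia. Qed.

(** The third entry is largest at the smallest sum [k.-1./2], where it exceeds [2k] by [k-1] for odd
    [k] and by [k] for even [k]. *)
Lemma triple_lt (k i j : nat) : i < k -> j < 3 -> triple k i j < 3 * k + ~~ odd k.
Proof.
move=> hi; have := mid_perm_lt hi; have := add_mid_perm_ge hi.
by case: j => [|[|[|//]]] /=; lia.
Qed.

Lemma triple_inj (k i j i' j' : nat) : i < k -> j < 3 -> i' < k -> j' < 3 ->
  triple k i j = triple k i' j' -> i = i' /\ j = j'.
Proof.
move=> hi hj hi' hj'.
have := mid_perm_lt hi; have := mid_perm_lt hi'.
have := add_mid_perm_le hi; have := add_mid_perm_le hi'.
have := @mid_perm_inj _ _ _ hi hi'; have := @add_mid_perm_inj _ _ _ hi hi'.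
case: j hj => [|[|[|//]]] _; case: j' hj' => [|[|[|//]]] _ /=; lia.
Qed.

Lemma balanced_array_odd (k n : nat) :
  odd n -> 1 < n -> balanced_array k n (k * n + ~~ odd k) (odd_array k).
Proof.
move=> on hn; split.
- move=> i j i' j' hi hj hi' hj'; rewrite /odd_array.
  case: ifP => h3; case: ifP => h3'.
  + exact: triple_inj.
  + by have := triple_lt hi h3; lia.
  + by have := triple_lt hi' h3'; lia.
  + by move/addnI/zigzag_inj => [] //; lia.
- move=> i j hi hj; rewrite /odd_array.
  case: ifP => h3.
    have := triple_lt hi h3; have : k * 3 <= k * n by rewrite leq_mul2l; lia.
    lia.
  have : zigzag k i (j - 3) < (n - 3) * k by apply: zigzag_lt; lia.
  by nia.
move=> i i' hi hi'.
have [q ->] : exists q, n = 3 + q.*2 by exists (n - 3)./2; lia.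
rewrite !big_split_ord /=; congr (_ + _).
  rewrite !big_ord_recr !big_ord0 /= /odd_array /=.
  by have := add_mid_perm_le hi; have := add_mid_perm_le hi'; lia.
have E x (j : 'I_(q.*2)) : odd_array k x (3 + j) = 3 * k + ~~ odd k + zigzag k x j.
  by rewrite /odd_array ltnNge leq_addr /= addKn.
do 2!rewrite (eq_bigr _ (fun j _ => E _ j)).
exact: sum_zigzag.
Qed.

(** * Magic labellings and part sums *)

Section Labellings.
Variables m n p : nat.

Local Notation G := (copies m (complete_multipartite n p)).

Definition part_sum (f : G -> nat) (a : 'I_m) (b : 'I_p) : nat :=
  \sum_(c < n) f (a, (b, c)).

Lemma card_copies_multipartite : #|G| = m * p * n.
Proof. by rewrite !card_prod !card_ord mulnA. Qed.

Lemma sum_nbrs (f : G -> nat) (u : G) :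
  \sum_(v in nbrs u) f v = \sum_(b | b != u.2.1) part_sum f u.1 b.
Proof.
case: u => a [b0 c0] /=.
rewrite /part_sum pair_big_dep /=.
rewrite (reindex_onto (fun x : 'I_p * 'I_n => (a, x) : G) (fun v : G => v.2)) /=.
  apply: eq_big => [[b c]|[b c] _] //=.
  by rewrite inE /= /copies_edge /= /cmp_edge /= !eqxx eq_sym ?andbT.
by case=> a' x; rewrite inE /= /copies_edge /= => /andP[/eqP <-].
Qed.

Lemma sum_part_sum (f : G -> nat) :
  \sum_(v : G) f v = \sum_(a < m) \sum_(b < p) part_sum f a b.
Proof.
rewrite pair_bigA /part_sum /= pair_bigA /=.
rewrite (reindex (fun x : 'I_m * 'I_p * 'I_n => (x.1.1, (x.1.2, x.2)) : G)) //=.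
by exists (fun v : G => (v.1, v.2.1, v.2.2)) => [[[a b] c]|[a [b c]]].
Qed.

(** A part sum plus [c] is the total of its copy, so parts of one copy agree. Then [c] is [p.-1]
    times the part sum, which makes different copies agree as well. *)
Lemma part_sum_const (f : G -> nat) (c : nat) : 1 < p -> 0 < n ->
  (forall u : G, \sum_(v in nbrs u) f v = c) ->
  forall a b a' b', part_sum f a b = part_sum f a' b'.
Proof.
move=> hp hn hc.
have sumD1 a b : \sum_(b' < p) part_sum f a b' = part_sum f a b + c.
  by rewrite (bigD1 b) //= -(hc (a, (b, Ordinal hn))) sum_nbrs.
have eqb a b b' : part_sum f a b = part_sum f a b'.
  by have := sumD1 a b; rewrite (sumD1 a b') => /addIn.
have eqc a b : c = p.-1 * part_sum f a b.
  have := sumD1 a b; rewrite (eq_bigr _ (fun b' _ => eqb a b' b)).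
  by rewrite sum_nat_const card_ord; case: (p) hp => // q _ /=; lia.
move=> a b a' b'; have := eqc a b; rewrite (eqc a' b') => /eqP.
by rewrite eqn_pmul2l; [move/eqP|lia].
Qed.

Lemma balanced_array_magic (N : nat) (g : nat -> nat -> nat) :
  balanced_array (m * p) n N g ->
  exists S : {fset nat}, S_magic G S /\ alpha S <= N.
Proof.
case=> ginj glt gsum.
pose row (a : 'I_m) (b : 'I_p) := a * p + b.
have row_lt a b : row a b < m * p.
  have : a.+1 * p <= m * p by rewrite leq_mul2r ltn_ord orbT.
  by rewrite /row; have := ltn_ord b; lia.
(* The successor makes labels positive and turns the strict bound [N] on entries into a bound on the
   maximum. *)
pose h (v : G) := (g (row v.1 v.2.1) v.2.2).+1.
have h_inj : injective h.
  move=> [a [b c]] [a' [b' c']] []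
    /(ginj _ _ _ _ (row_lt a b) (ltn_ord c) (row_lt a' b') (ltn_ord c')) [].
  move/(digits_inj (ltn_ord b) (ltn_ord b')) => [ea eb] ec.
  by congr (_, (_, _)); apply: val_inj.
pose S := [fset h v | v in [set: G]]%fset.
have hS v : h v \in S by apply/imfsetP; exists v; rewrite ?inE.
have cardS : #|` S| = #|G| by rewrite card_imfset //= -cardE cardsT.
exists S; split; last first.
  rewrite /alpha; apply/bigmax_leqP_seq => x /imfsetP[v _ ->] _.
  exact: glt.
split=> //; first by move=> x /imfsetP[v _ ->].
exists (fun v => [` hS v]%fset); split.
  apply: inj_card_bij => [v v' /(congr1 val)/h_inj //|].
  by rewrite -cardS cardfE.
have psum a b a' b' : part_sum h a b = part_sum h a' b'.
  have E x y : part_sum h x y = \sum_(j < n) g (row x y) j + n.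
    rewrite -[X in _ + X]card_ord -sum1_card -big_split /=.
    by apply: eq_bigr => j _; rewrite addn1.
  by rewrite !E; congr (_ + _); apply: gsum.
(* Any vertex supplies the common part sum; on an empty graph any constant serves. *)
case: (pickP (fun _ : G => true)) => [[a0 [b0 c0]] _|none]; last first.
  by exists 0 => u; have := none u.
exists (p.-1 * part_sum h a0 b0) => u; rewrite (sum_nbrs h).
rewrite (eq_bigr _ (fun b _ => psum u.1 b a0 b0)) sum_nat_const.
by rewrite cardC1 card_ord.
Qed.

(** The labels must be exactly [1, .., m p n], whose sum is shared equally by the [m p] parts; [s]
    is the sum over one part. *)
Lemma magic_sum (S : {fset nat}) : 1 < p -> 0 < n -> 0 < m ->
  S_magic G S -> alpha S = #|G| ->
  exists s : nat, s.*2 = n * (m * p * n).+1.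
Proof.
move=> hp hn hm [S0 cardS [f [f_bij [c hc]]]].
rewrite card_copies_multipartite => aS.
pose s := [seq fsval (f v) | v <- enum G].
have us : uniq s.
  by rewrite map_inj_uniq ?enum_uniq // => v v' /val_inj; apply: bij_inj.
have ss : {subset s <= iota 1 (m * p * n)}.
  move=> x /mapP[v _ ->]; have vS := fsvalP (f v).
  rewrite mem_iota S0 //= add1n ltnS -aS.
  exact: (@leq_bigmax_seq _ _ xpredT id).
(* A duplicate-free list inside the interval and at least as long must exhaust it. *)
have sz : size (iota 1 (m * p * n)) <= size s.
  by rewrite size_iota size_map -cardE card_copies_multipartite.
have ps : perm_eq s (iota 1 (m * p * n)).
  apply: uniq_perm; rewrite ?iota_uniq //.
  by case: (uniq_min_size us ss sz).
have tot : \sum_(v : G) fsval (f v) = \sum_(x <- iota 1 (m * p * n)) x.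
  by rewrite -(perm_big _ ps) /= big_map big_enum.
have tri N : (\sum_(x <- iota 1 N) x).*2 = N * N.+1.
  elim: N => [|N IH]; first by rewrite big_nil.
  by rewrite -[in iota _ N.+1](addn1 N) iotaD big_cat /= big_seq1 doubleD IH; nia.
have p0 : 0 < p by lia.
pose a0 := Ordinal hm; pose b0 := Ordinal p0.
pose t := part_sum (fun v => fsval (f v)) a0 b0; exists t.
have := tri (m * p * n); rewrite -tot (sum_part_sum (fun v => fsval (f v))).
have E a b := part_sum_const hp hn hc a b a0 b0.
rewrite (eq_bigr (fun=> p * t)) => [|a _]; last first.
  by rewrite (eq_bigr _ (fun b _ => E a b)) sum_nat_const card_ord.
rewrite sum_nat_const card_ord => /eqP.
rewrite mulnA doubleMr -(mulnA (m * p) n) eqn_pmul2l ?muln_gt0 ?hm //.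
by move/eqP.
Qed.

End Labellings.

(** * Bounds on the distance magic index *)

Lemma magic_alpha_ge (G : sgraph) (S : {fset nat}) :
  S_magic G S -> #|G| <= alpha S.
Proof.
case=> S0 <- _; rewrite -[leqRHS](size_iota 1).
apply: uniq_leq_size; first exact: fset_uniq.
move=> x xS; rewrite mem_iota S0 //= add1n ltnS.
exact: (@leq_bigmax_seq _ _ xpredT id).
Qed.

Lemma theta_eq (G : sgraph) (d : nat) :
  (exists S, S_magic G S /\ alpha S <= #|G| + d) ->
  (forall S, S_magic G S -> #|G| + d <= alpha S) ->
  theta G = Some (d%:Z)%R.
Proof.
move=> [S [magS leS]] lb; rewrite /theta /i_index.
case: pselect => [ex_k|[]]; last by exists (alpha S); apply/asboolP; exists S.
case: ex_minnP => k /asboolP[S' [magS' eqS']] kmin /=.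
have kle : k <= alpha S by apply: kmin; apply/asboolP; exists S.
have := lb _ magS'; rewrite eqS' => kge.
have -> : k = #|G| + d by apply/eqP; rewrite eqn_leq kge (leq_trans kle).
by rewrite PoszD GRing.addrC GRing.addKr.
Qed.

Theorem theorem13 (m n p : nat) (hn : 1 < n) (hp : 1 < p) (hm : 1 <= m) :
  (~~ odd n \/ odd (m * n * p) ->
     theta (copies m (complete_multipartite n p)) = Some (0%:Z)%R) /\
  (~ (~~ odd n \/ odd (m * n * p)) ->
     theta (copies m (complete_multipartite n p)) = Some (1%:Z)%R).
Proof.
have arr (on : odd n) := balanced_array_magic (balanced_array_odd (m * p) on hn).
split.
- move=> H; apply: theta_eq => [|S]; rewrite addn0; last exact: magic_alpha_ge.
  rewrite card_copies_multipartite.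
  have [on|en] := boolP (odd n); last first.
    exact: balanced_array_magic (balanced_array_even (m * p) en).
  (* For odd [m p] the odd construction leaves no integer out. *)
  have := arr on; suff -> : odd (m * p) by rewrite addn0.
  by case: H; rewrite ?on // !oddM on andbT.
- move=> /not_orP[/negP/negPn on /negP]; rewrite !oddM on andbT -oddM => emp.
  apply: theta_eq => [|S magS].
    by rewrite card_copies_multipartite; have := arr on; rewrite emp.
  rewrite addn1 ltn_neqAle magic_alpha_ge // andbT; apply/eqP => eqS.
  (* With [n] odd and [m p] even, [n (m p n + 1)] is odd and cannot be a double. *)
  have [s /(congr1 odd)] := magic_sum hp (ltnW hn) hm magS (esym eqS).
  by rewrite odd_double oddM on /= oddM (negbTE emp).
Qed.
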